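(* Let $S$ be a finite set, $X^+=S^{\mathbb{Z}_+}$, and let $g:X^+\to[0,1]$ be a $g$-function with $g>0$ and with square summable variations, i.e. $\sum_{n=1}^\infty(\operatorname{var}_n g)^2<\infty$. Let $\mu$ be the corresponding unique $g$-measure. Then for every continuous function $f:X^+\to\mathbb{R}$, $$\sup_{x\in X^+}\left|\mathcal{L}^n f(x)-\int f\,d\mu\right|\to 0\quad\text{as } n\to\infty .$$
   Context: $S$ is a finite set (the alphabet) with the discrete topology, $X^+=S^{\mathbb{Z}_+}$ with $\mathbb{Z}_+=\{0,1,2,\dots\}$ and the product topology, and $T:X^+\to X^+$ is the one-sided left shift $T(x_0,x_1,x_2,\ldots)=(x_1,x_2,\ldots)$. A $g$-function is a continuous function $g:X^+\to[0,1]$ with $\sum_{y\in T^{-1}x} g(y)=1$ for all $x\in X^+$. A $g$-measure associated to $g$ is a $T$-invariant Borel probability measure $\mu$ on $X^+$ such that $g=d\mu/d(\mu\circ T)$, where $\mu\circ T$ is the measure $B\mapsto\sum_{s\in S}\mu(T(B\cap\{x: x_0=s\}))$. Under the hypotheses of the statement it is known that there is exactly one $g$-measure. For $f:X^+\to\mathbb{R}$, $\operatorname{var}_n f=\sup\{|f(x)-f(y)| : x,y\in X^+ \text{ coincide in the first } n \text{ coordinates}\}$. The transfer operator acts on continuous $f:X^+\to\mathbb{R}$ by $\mathcal{L}f(x)=\sum_{y\in T^{-1}x} g(y)f(y)$, and $\mathcal{L}^n$ is its $n$-th iterate. *)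

(* Defs.v *)
From HB Require Import structures.
From mathcomp Require Import all_boot all_order all_algebra.
From mathcomp Require Import all_classical all_reals all_analysis.

Set Implicit Arguments.
Unset Strict Implicit.
Unset Printing Implicit Defensive.

Import Order.TTheory GRing.Theory Num.Theory.
Import numFieldNormedType.Exports.

Local Open Scope classical_set_scope.
Local Open Scope ring_scope.

(* Nonempty finite types: [measurableType] requires a distinguished point; which
   point it is plays no role below. *)
#[short(type="pointedFinType")]
HB.structure Definition PointedFinite := {T of Pointed T & Finite T}.

Lemma continuous_prod_topology {T : topologicalType} {I : Type}
    {K : I -> topologicalType} (f : T -> prod_topology K) :
  (forall i, continuous (fun t => f t i)) -> continuous f.
Proof.
move=> cf x; apply/cvg_sup => i; move: x.
apply/(@continuousP _ (initial_topology (@^~ i))) => A [B oB <-].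
by apply: (@open_comp _ _ (fun t => f t i)) oB => t _; exact: cf.
Qed.

Section shift_space.
Variable S : pointedFinType.

Definition shift_space : Type :=
  prod_topology (fun _ : nat => discrete_topology S).

HB.instance Definition _ := Pointed.on shift_space.
HB.instance Definition _ := Topological.on shift_space.
HB.instance Definition _ := Measurable.copy shift_space
  (g_sigma_algebraType (@open shift_space)).

Definition left_shift (x : shift_space) : shift_space := fun n => x n.+1.

Definition cylinder (s : S) : set shift_space := [set x | x 0%N = s].

Definition scons (s : S) (x : shift_space) : shift_space :=
  fun n => if n is m.+1 then x m else s.

Lemma scons_continuous s : continuous (scons s).
Proof.
apply: continuous_prod_topology => -[|n].
- exact: cst_continuous.
- exact: (@proj_continuous nat (fun=> discrete_topology S)).
Qed.

Lemma measurable_scons s : measurable_fun setT (scons s).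
Proof.
apply: measurability => [//|].
move=> _ [A oA <-]; rewrite setTI; apply: sub_sigma_algebra.
by apply: open_comp => // x _; exact: scons_continuous.
Qed.

Lemma shift_cylinderE s (B : set shift_space) :
  left_shift @` (B `&` cylinder s) = scons s @^-1` B.
Proof.
apply/seteqP; split=> [_ [x [Bx x0] <-]|x Bx] /=; last first.
  by exists (scons s x).
suff -> : scons s (left_shift x) = x by [].
by apply/funext => -[|n] //=; rewrite x0.
Qed.

Section comp_shift.
Context {R : realType} (mu : {measure set shift_space -> \bar R}).
Local Open Scope ereal_scope.

(* The measure usually written [mu \o T]. The instances below rest on
   [shift_cylinderE]: [left_shift] maps each cylinder homeomorphically onto the
   whole space, so its image of a Borel subset of a cylinder is Borel. *)
Definition comp_shift (B : set shift_space) : \bar R :=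
  \sum_(s : S) mu (left_shift @` (B `&` cylinder s)).

Let comp_shift0 : comp_shift set0 = 0.
Proof.
by rewrite /comp_shift big1// => s _; rewrite set0I image_set0 measure0.
Qed.

Let comp_shift_ge0 B : 0 <= comp_shift B.
Proof. by apply: sume_ge0 => s _. Qed.

Let measurable_preimage_scons s (B : set shift_space) :
  measurable B -> measurable (scons s @^-1` B).
Proof. by move=> mB; rewrite -[X in measurable X]setTI; exact: measurable_scons. Qed.

Let comp_shift_sigma_additive : semi_sigma_additive comp_shift.
Proof.
move=> F mF tF mUF; rewrite /comp_shift.
under eq_fun do rewrite exchange_big/=.
apply: cvg_nnesum => s _; first by apply: nearW => n; exact: sume_ge0.
rewrite shift_cylinderE preimage_bigcup.
under eq_fun do under eq_bigr do rewrite shift_cylinderE.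
apply: measure_semi_sigma_additive.
- by move=> n; exact: measurable_preimage_scons.
- apply/trivIsetP => i j _ _ ij; rewrite -preimage_setI.
  by move/trivIsetP : tF => -> //; rewrite preimage_set0.
- by rewrite -preimage_bigcup; exact: measurable_preimage_scons.
Qed.

HB.instance Definition _ := isMeasure.Build _ _ _ comp_shift
  comp_shift0 comp_shift_ge0 comp_shift_sigma_additive.

End comp_shift.

Section comp_shift_finite.
Context {R : realType} (mu : {finite_measure set shift_space -> \bar R}).
Local Open Scope ereal_scope.

Let comp_shift_fin : fin_num_fun (comp_shift mu).
Proof.
move=> B mB; rewrite /comp_shift sum_fin_num; apply/allP => _ /mapP[s _ ->].
rewrite shift_cylinderE; apply: fin_num_measure.
by rewrite -[X in measurable X]setTI; exact: measurable_scons.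
Qed.

HB.instance Definition _ := Measure_isFinite.Build _ _ _ (comp_shift mu)
  comp_shift_fin.

End comp_shift_finite.

Section g_functions.
Local Open Scope charge_scope.
Context {R : realType}.
Implicit Types f g : shift_space -> R.

Definition g_function g :=
  [/\ continuous g, forall x, 0 <= g x <= 1
    & forall x, \sum_(y \in left_shift @^-1` [set x]) g y = 1].

Definition g_measure g (mu : probability shift_space R) :=
  [/\ forall B, measurable B -> pushforward mu left_shift B = mu B,
      mu `<< comp_shift mu
    & 'd (charge_of_finite_measure mu) '/d (comp_shift mu) = EFin \o g
        %[ae comp_shift mu]].

(* Valued in [\bar R], so that no boundedness of [f] is presupposed. *)
Definition varn f (n : nat) : \bar R :=
  ereal_sup [set `|f p.1 - f p.2|%:E | p in
    [set p : shift_space * shift_space |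
      forall i, (i < n)%N -> p.1 i = p.2 i]].

Definition transfer_op g f : shift_space -> R :=
  fun x => \sum_(y \in left_shift @^-1` [set x]) g y * f y.

End g_functions.

End shift_space.

(* Main.v *)
Require Import Defs.
From mathcomp Require Import all_boot all_order all_algebra.
From mathcomp Require Import all_classical all_reals all_analysis.
From mathcomp Require Import measurable_realfun ring lra.

Import Order.TTheory GRing.Theory Num.Theory.
Import numFieldNormedType.Exports.

Local Open Scope classical_set_scope.
Local Open Scope ring_scope.

(* Write [p_x(w)] for the weight of the word [w] in
   [L^m f(x) = sum_w p_x(w) f(wx)].
   If [x] and [y] agree in [n] coordinates, the Hellinger affinity
   [sum_w sqrt (p_x(w) p_y(w))] is at least [1 - C sum_(k > n) (var_k g)^2],
   uniformly in the length of [w], because prepending a letter lengthens the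
   agreement by one. Hence the iterates [L^m f] are equicontinuous. Since
   [g >= c > 0], two points can be moved along the same word of length [n], of
   weight at least [c^n], to points that agree in [n] coordinates; so [L^n]
   contracts the oscillation of every [L^m f] by the factor [1 - c^n], up to an
   error given by equicontinuity. As [int L f dmu = int f dmu],
   the limit is the constant [int f dmu]. *)

(** * Topology of the shift space: agreement neighbourhoods, compactness, uniform continuity *)

Section shift_space_topology.
Context {S : pointedFinType}.
Implicit Types x y : shift_space S.

Definition agree (n : nat) x y := forall i, (i < n)%N -> x i = y i.

Lemma agree_scons n s x y : agree n x y -> agree n.+1 (scons s x) (scons s y).
Proof. by move=> xy [//|i] /xy. Qed.

Lemma agree_iter_scons n s x y :
  agree n (iter n (scons s) x) (iter n (scons s) y).
Proof. by elim: n => // n IHn; rewrite !iterS; exact: agree_scons. Qed.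

Lemma shift_space_compact : compact [set: shift_space S].
Proof.
have Sc (i : nat) : compact [set: discrete_topology S].
  exact: (@finite_compact (discrete_topology S) _ (@finite_finset S setT)).
by have := @tychonoff _ _ _ Sc; congr compact; apply/seteqP.
Qed.

Lemma agree_nbhs n x : nbhs x (agree n x).
Proof.
suff : nbhs x [set y : shift_space S | forall i : 'I_n, x i = y i].
  by apply: filterS => y xy i ni; exact: (xy (Ordinal ni)).
have FF := @nbhs_filter (shift_space S) x.
pose P (i : 'I_n) (y : shift_space S) := x i = y i.
apply: (@filter_forall _ _ P _ FF) => i.
have := @proj_continuous nat (fun=> discrete_topology S) i x
  _ (discrete_set1 (x i : discrete_topology S)).
by apply: filterS => y /= ->.
Qed.

(** Convergence in the product topology is tested on each coordinate separately, and coordinate [i]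
    is already frozen on [agree i.+1 x]. So the filter generated by the sets [agree n x] converges
    to [x]. *)
Lemma nbhs_agree x (U : set (shift_space S)) :
  nbhs x U -> exists n, agree n x `<=` U.
Proof.
pose F := filter_from [set: nat] (fun n => agree n x).
have FF : Filter F.
  apply: filter_from_filter => [|i j _ _]; first by exists 0%N.
  exists (maxn i j) => // y xy; split=> k ki; apply: xy.
    by rewrite (leq_trans ki)// leq_maxl.
  by rewrite (leq_trans ki)// leq_maxr.
suff /[apply] : F --> x by move=> [n _ nU]; exists n.
apply/(@cvg_sup _ _ _ F x) => i A [_ [[B _ <-] Bx BA]].
by exists i.+1 => // y xy; apply: BA; rewrite /= -xy.
Qed.

Context {R : realType}.

(** Uniform continuity by compactness: each point [x] has its own [n] for [e / 2], and two points
    that both agree with [x] that far have values within [e] of each other. *)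
Lemma continuous_agree (f : shift_space S -> R) (e : R) :
  continuous f -> 0 < e ->
  exists n, forall x y, agree n x y -> `|f x - f y| <= e.
Proof.
move=> cf e0.
have : \forall n \near \oo, setT `<=`
    fun x => forall y, agree n x y -> `|f x - f y| <= e.
  apply: ((compact_near_coveringP _).1 shift_space_compact) => x _.
  have /cf/nbhs_agree[n nU] : nbhs (f x) (ball (f x) (e / 2)).
    by apply: nbhsx_ballx; rewrite divr_gt0.
  exists (agree n x, [set m | (n <= m)%N]).
    by split; [exact: agree_nbhs|exact: nbhs_infty_ge].
  move=> [y m] [/= xy nm] z yz.
  have xz : agree n x z by move=> i ni; rewrite xy// yz// (leq_trans ni).
  have := nU _ xy; have := nU _ xz; rewrite /ball/= => h1 h2.
  rewrite [e]splitr (le_trans (ler_distD (f x) _ _))// lerD// ltW//.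
  by rewrite distrC.
by case=> n _ /(_ n (leqnn n)) h; exists n => x y; exact: h.
Qed.

Lemma continuous_shift_space_bounded (f : shift_space S -> R) :
  continuous f -> exists2 K, 0 < K & forall x, `|f x| <= K.
Proof.
move=> cf.
have /compact_bounded : compact (f @` setT).
  apply: continuous_compact shift_space_compact.
  exact: continuous_subspaceT.
case=> K [_ bK]; exists (Num.max K 0 + 1) => [|x].
  by rewrite ltr_wpDl// le_max lexx orbT.
by apply: (bK (Num.max K 0 + 1)); [rewrite ltr_pwDr// le_max lexx|exists x].
Qed.

(** The reciprocal of [g] is continuous, hence bounded on a compact space; the inverse of its bound
    serves as [c]. *)
Lemma continuous_gt0_lbound (g : shift_space S -> R) :
  continuous g -> (forall x, 0 < g x) -> exists2 c, 0 < c & forall x, c <= g x.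
Proof.
move=> cg g0.
have [x|K K0 gK] := @continuous_shift_space_bounded (fun x => (g x)^-1).
  apply: (@continuous_comp _ _ _ g GRing.inv); first exact: cg.
  by apply: inv_continuous; rewrite gt_eqF.
exists K^-1 => [|x]; first by rewrite invr_gt0.
rewrite -[g x]invrK lef_pV2 ?posrE ?invr_gt0//.
by rewrite (le_trans (ler_norm _))// gK.
Qed.

Lemma continuous_measurable (f : shift_space S -> R) :
  continuous f -> measurable_fun setT f.
Proof.
move=> cf; apply: (measurability _ (RGenOpens.measurableE R)) => //.
move=> _ [_ [a [b ->]] <-]; rewrite setTI; apply: sub_sigma_algebra.
by apply: open_comp => [x _|]; [exact: cf|exact: itv_open].
Qed.

End shift_space_topology.

(** * The transfer operator as a sum over letters, and its contraction of oscillations *)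

Section transfer_operator.
Context {R : realType} {S : pointedFinType}.
Implicit Types (x y : shift_space S) (F g : shift_space S -> R).

(** The fibre of the shift over [x] is the injective image of the alphabet under
    [s => scons s x]. *)
Lemma transfer_opE g F x :
  transfer_op g F x = \sum_(s : S) g (scons s x) * F (scons s x).
Proof.
rewrite /transfer_op.
have -> : @left_shift S @^-1` [set x] = (fun s => scons s x) @` [set: S].
  apply/seteqP; split=> [y /= <-|_ [s _ <-]//].
  by exists (y 0%N) => //; apply/funext => -[].
rewrite fsbig_image; last by move=> s t _ _ /(congr1 (fun y => y 0%N)).
rewrite (fsbigE (index_enum S)) ?index_enum_uniq//=.
  by apply: eq_bigl => s; rewrite in_setT.
by move=> s; rewrite mem_index_enum.
Qed.

Lemma continuous_transfer_op g F :
  continuous g -> continuous F -> continuous (transfer_op g F).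
Proof.
move=> cg cF; have -> : transfer_op g F =
    fun x => \sum_(s : S) g (scons s x) * F (scons s x).
  by apply/funext => x; rewrite transfer_opE.
apply: continuous_big => [|s _ x]; first exact: add_continuous.
apply: (@continuousM _ _ (g \o scons s) (F \o scons s)).
  exact: (continuous_comp (@scons_continuous S s x) (cg _)).
exact: (continuous_comp (@scons_continuous S s x) (cF _)).
Qed.

Lemma iter_transfer_opN g F n :
  iter n (transfer_op g) (\- F) = \- iter n (transfer_op g) F.
Proof.
elim: n => //= n ->; apply/funext => x.
rewrite transfer_opE /= transfer_opE -sumrN.
by apply: eq_bigr => s _; rewrite mulrN.
Qed.

Section normalised.
Context (g : shift_space S -> R) (c : R).
Hypothesis g_sum1 : forall x, \sum_(s : S) g (scons s x) = 1.
Hypothesis c_ge0 : 0 <= c.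
Hypothesis g_ge : forall x, c <= g x.
Local Notation L := (transfer_op g).

Let g_ge0 x : 0 <= g x.
Proof. exact: le_trans (g_ge x). Qed.

(** The iterate averages [F] over words of length [n] put before [x]. The constant word in [s] has
    weight at least [c ^+ n], so its shortfall below [M] counts at least that much; every other word
    contributes a nonnegative shortfall. *)
Lemma iter_transfer_op_le (s : S) F M n x : (forall y, F y <= M) ->
  iter n L F x <= M - c ^+ n * (M - F (iter n (scons s) x)).
Proof.
move=> FM; elim: n x => [x|n IHn x]; first by rewrite expr0 mul1r subKr.
have LM y : iter n L F y <= M.
  rewrite (le_trans (IHn y))// lerBlDr lerDl.
  by rewrite mulr_ge0 ?exprn_ge0 ?subr_ge0.
have -> : iter n.+1 L F x =
    M - \sum_(t : S) g (scons t x) * (M - iter n L F (scons t x)).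
  rewrite iterS transfer_opE; under [in RHS]eq_bigr do rewrite mulrBr.
  by rewrite sumrB -mulr_suml g_sum1 mul1r subKr.
rewrite lerB// (bigD1 s)//= ler_wpDr ?sumr_ge0// => [t _|].
  by rewrite mulr_ge0 ?subr_ge0.
rewrite exprS -mulrA ler_pM ?mulr_ge0 ?exprn_ge0 ?subr_ge0//.
by rewrite -iterS iterSr lerBrDr addrC -lerBrDr.
Qed.

Lemma iter_transfer_op_ge (s : S) F m n x : (forall y, m <= F y) ->
  m + c ^+ n * (F (iter n (scons s) x) - m) <= iter n L F x.
Proof.
move=> mF; have := @iter_transfer_op_le s (\- F) (- m) n x.
rewrite iter_transfer_opN /= => /(_ _)/wrap[y|]; first by rewrite lerN2.
by rewrite lerNl; congr (_ <= _); ring.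
Qed.

Lemma iter_transfer_op_bounds F m M n : (forall x, m <= F x <= M) ->
  forall x, m <= iter n L F x <= M.
Proof.
move=> FmM x; have s : S := point.
have Fm y : m <= F y by case/andP: (FmM y).
have FM y : F y <= M by case/andP: (FmM y).
rewrite (le_trans _ (iter_transfer_op_ge s F m n x Fm))/=; last first.
  by rewrite lerDl mulr_ge0 ?exprn_ge0 ?subr_ge0.
rewrite (le_trans (iter_transfer_op_le s F M n x FM))//.
by rewrite lerBlDr lerDl mulr_ge0 ?exprn_ge0 ?subr_ge0.
Qed.

Lemma transfer_op_contraction F m M n e : (forall x, m <= F x <= M) ->
    (forall x y, agree n x y -> `|F x - F y| <= e) ->
  exists m' M', (forall x, m' <= iter n L F x <= M') /\
    M' - m' = (1 - c ^+ n) * (M - m) + c ^+ n * (2 * e).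
Proof.
move=> FmM Fe; have s : S := point.
have Fm y : m <= F y by case/andP: (FmM y).
have FM y : F y <= M by case/andP: (FmM y).
(* [v] is a reference value independent of [x]: prefixing [n] copies of [s] to any [x] gives a point
   where [F] is within [e] of [v]. This pulls the lower bound up and the upper bound down along the
   same word. *)
pose v := F (iter n (scons s) point).
exists (m + c ^+ n * (v - e - m)), (M - c ^+ n * (M - v - e)).
split=> [x|]; last by ring.
have := Fe _ _ (agree_iter_scons n s x point).
rewrite -/v ler_distl => /andP[h1 h2].
rewrite (le_trans _ (iter_transfer_op_ge s F m n x Fm))/=; last first.
  by rewrite lerD2l ler_wpM2l ?exprn_ge0// lerD2r.
rewrite (le_trans (iter_transfer_op_le s F M n x FM))//.
rewrite lerD2l lerN2 ler_wpM2l ?exprn_ge0//; lra.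
Qed.

(** The recursion [d -> (1 - c ^+ n) * d + c ^+ n * (2 * e)] has fixed point [2 * e], and each block
    of [n] iterations shrinks the excess over it by [1 - c ^+ n]. *)
Lemma transfer_op_iter_contraction F K n e : c <= 1 ->
    (forall x, `|F x| <= K) ->
    (forall j x y, agree n x y -> `|iter j L F x - iter j L F y| <= e) ->
  forall k, exists m M, (forall x, m <= iter (k * n) L F x <= M) /\
    M - m <= 2 * e + (1 - c ^+ n) ^+ k * (2 * K).
Proof.
move=> c1 FK Fe; elim=> [|k [m [M [kmM IHk]]]].
  exists (- K), K; split=> [x|]; first by rewrite -ler_norml FK.
  (* Comparing a point with itself yields [0 <= e]. *)
  have := Fe 0%N point point (fun _ _ => erefl); rewrite subrr normr0 expr0.
  lra.
have [m' [M' [kmM' dE]]] :=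
  transfer_op_contraction _ _ _ _ _ kmM (Fe (k * n)%N).
exists m', M'; split=> [x|]; first by rewrite mulSn iterD.
have q0 : 0 <= 1 - c ^+ n by rewrite subr_ge0 exprn_ile1.
rewrite dE exprS; have := ler_wpM2l q0 IHk; lra.
Qed.

End normalised.
End transfer_operator.

(** * Equicontinuity of the iterates through the Hellinger affinity *)

Section equicontinuity.
Context {R : realType} {S : pointedFinType}.
Implicit Types (x y : shift_space S) (F g f : shift_space S -> R).

(** For [a = b = 1] this is the squared Hellinger distance, twice the defect of the affinity from
    1. *)
Lemma sum_sqrt_affinity (I : finType) (p q : I -> R) (a b : R) :
    (forall i, 0 <= p i) -> (forall i, 0 <= q i) ->
    \sum_i p i = 1 -> \sum_i q i = 1 ->
  \sum_i (a * Num.sqrt (p i) - b * Num.sqrt (q i)) ^+ 2 =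
  a ^+ 2 + b ^+ 2 - 2 * (a * b) * \sum_i Num.sqrt (p i) * Num.sqrt (q i).
Proof.
move=> p0 q0 p1 q1.
transitivity (\sum_i (a ^+ 2 * p i + b ^+ 2 * q i -
    2 * (a * b) * (Num.sqrt (p i) * Num.sqrt (q i)))).
  apply: eq_bigr => i _.
  rewrite -[X in a ^+ 2 * X](sqr_sqrtr (p0 i)).
  by rewrite -[X in b ^+ 2 * X](sqr_sqrtr (q0 i)); ring.
by rewrite sumrB big_split/= -!mulr_sumr p1 q1 !mulr1.
Qed.

(** Since [p - q] is the product of the difference and the sum of the square roots, and the squared
    sum is at least [p i >= c], each squared difference of roots is at most [u / c]. The defect is
    half the sum of these. *)
Lemma sqrt_affinity_defect (I : finType) (p q : I -> R) (c u : R) :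
    0 < c -> (forall i, c <= p i) -> (forall i, 0 <= q i) ->
    \sum_i p i = 1 -> \sum_i q i = 1 ->
    (forall i, (p i - q i) ^+ 2 <= u) ->
  1 - \sum_i Num.sqrt (p i) * Num.sqrt (q i) <= #|I|%:R / (2 * c) * u.
Proof.
move=> c0 pc q0 p1 q1 pqu.
have p0 i : 0 <= p i by rewrite (le_trans (ltW c0)).
have := sum_sqrt_affinity I p q 1 1 p0 q0 p1 q1.
set h := \sum_i Num.sqrt _ * _ => hE.
suff : \sum_i (1 * Num.sqrt (p i) - 1 * Num.sqrt (q i)) ^+ 2 <=
    #|I|%:R * (u / c).
  rewrite hE.
  have -> : #|I|%:R / (2 * c) * u = #|I|%:R * (u / c) / 2.
    by field; rewrite gt_eqF.
  by move=> ?; lra.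
rewrite mulr_natl -sumr_const; apply: ler_sum => i _.
rewrite !mul1r ler_pdivlMr// (le_trans _ (pqu i))//.
rewrite -{2}(sqr_sqrtr (p0 i)) -{2}(sqr_sqrtr (q0 i)) subr_sqr exprMn.
rewrite ler_wpM2l ?sqr_ge0// (le_trans (pc i))// -{1}(sqr_sqrtr (p0 i)).
by rewrite lerXn2r ?nnegrE ?addr_ge0 ?sqrtr_ge0// lerDl sqrtr_ge0.
Qed.

Section affinity_defect.
Context (g : shift_space S -> R) (tau : nat -> R).
Hypothesis g_ge0 : forall x, 0 <= g x.
Hypothesis g_sum1 : forall x, \sum_(s : S) g (scons s x) = 1.
Hypothesis tau_ge0 : forall n, 0 <= tau n.
(** [tau] plays the part of a tail of a series: prepending one letter costs at most one term in
    affinity and raises the agreement by one, so the total cost over words of any length telescopes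
    to at most [tau n]. *)
Hypothesis tau_defect : forall n x y, agree n x y ->
  1 - \sum_(s : S) Num.sqrt (g (scons s x)) * Num.sqrt (g (scons s y)) <=
  tau n - tau n.+1.
Local Notation L := (transfer_op g).

(* The squared weights [a ^+ 2], [b ^+ 2] make the bound stable under the
   recursion, which multiplies [a] and [b] by [sqrt (g (sx))] and
   [sqrt (g (sy))]; only [a = b = 1] is wanted in the end. *)
Lemma iter_transfer_op_weighted_agree F n m x y (K v t a b : R) :
    0 < t -> (forall x, `|F x| <= K) ->
    (forall x y, agree n x y -> `|F x - F y| <= v) ->
    agree n x y -> 0 <= a -> 0 <= b ->
  `|a ^+ 2 * iter m L F x - b ^+ 2 * iter m L F y| <=
  (a ^+ 2 + b ^+ 2) * (v / 2 + K * t) +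
  K / (2 * t) * ((a - b) ^+ 2 + 2 * (a * b) * tau n).
Proof.
move=> t0 FK; have K0 : 0 <= K := le_trans (normr_ge0 _) (FK point).
have Kt0 : 0 <= K / (2 * t) by rewrite divr_ge0// mulr_ge0// ltW.
elim: m n x y a b => [|m IHm] n x y a b Fv xy a0 b0 /=.
  (* Symmetric splitting: the variation of [F] meets the mean weight, and the difference of the
     weights meets the mean of [F], which is at most [K]. *)
  have -> : a ^+ 2 * F x - b ^+ 2 * F y = (a ^+ 2 + b ^+ 2) / 2 * (F x - F y) +
      (a ^+ 2 - b ^+ 2) * ((F x + F y) / 2) by field.
  have A0 : 0 <= (a ^+ 2 + b ^+ 2) / 2 by rewrite divr_ge0// addr_ge0// sqr_ge0.
  rewrite (le_trans (ler_normD _ _))// [X in X + _]normrM [X in _ + X]normrM.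
  rewrite (ger0_norm A0).
  have h1 : (a ^+ 2 + b ^+ 2) / 2 * `|F x - F y| <= (a ^+ 2 + b ^+ 2) / 2 * v.
    by rewrite ler_wpM2l ?Fv.
  have h2 : `|(F x + F y) / 2| <= K.
    have := FK x; have := FK y; rewrite !ler_norml => /andP[? ?] /andP[? ?].
    by apply/andP; split; lra.
  (* AM-GM: [2 |a^2 - b^2| <= (a - b)^2 / t + t (a + b)^2] *)
  have h3 : `|a ^+ 2 - b ^+ 2| <=
      (a ^+ 2 + b ^+ 2) * t + (a - b) ^+ 2 / (2 * t).
    rewrite subr_sqr normrM (ger0_norm (addr_ge0 a0 b0)).
    rewrite -(real_normK (num_real (a - b))).
    have : 0 <= (`|a - b| - t * (a + b)) ^+ 2 / (2 * t).
      by rewrite divr_ge0 ?sqr_ge0// mulr_ge0// ltW.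
    have -> : (`|a - b| - t * (a + b)) ^+ 2 / (2 * t) =
        `|a - b| ^+ 2 / (2 * t) - `|a - b| * (a + b) + t * (a + b) ^+ 2 / 2.
      by field; rewrite gt_eqF.
    have : 0 <= t * (a - b) ^+ 2 / 2.
      by rewrite divr_ge0// mulr_ge0 ?sqr_ge0// ltW.
    rewrite -subr_ge0 => + h; rewrite -subr_ge0 => h'; lra.
  have h4 := ler_pM (normr_ge0 _) (normr_ge0 _) h3 h2.
  have h5 : 0 <= K / (2 * t) * (2 * (a * b) * tau n).
    by do 4 rewrite mulr_ge0//.
  rewrite (le_trans (lerD h1 h4))//.
  rewrite [leRHS](_ : _ = (a ^+ 2 + b ^+ 2) / 2 * v + ((a ^+ 2 + b ^+ 2) * t +
    (a - b) ^+ 2 / (2 * t)) * K + K / (2 * t) * (2 * (a * b) * tau n)).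
    by rewrite lerDl.
  by field; rewrite gt_eqF.
have FvS x' y' : agree n.+1 x' y' -> `|F x' - F y'| <= v.
  by move=> xy'; apply: Fv => i ni; apply: xy'; exact: ltnW.
pose p s := g (scons s x); pose q s := g (scons s y).
rewrite !transfer_opE !mulr_sumr -sumrB (le_trans (ler_norm_sum _ _ _))//.
pose h := \sum_s Num.sqrt (p s) * Num.sqrt (q s).
have hE := sum_sqrt_affinity S p q a b
  (fun=> g_ge0 _) (fun=> g_ge0 _) (g_sum1 x) (g_sum1 y).
(* The squared Hellinger distance [2 - 2 * h] is nonnegative. *)
have h1 : h <= 1.
  have := sum_sqrt_affinity S p q 1 1
    (fun=> g_ge0 _) (fun=> g_ge0 _) (g_sum1 x) (g_sum1 y).
  rewrite -/h => hE1; have : 0 <= 1 ^+ 2 + 1 ^+ 2 - 2 * (1 * 1) * h :> R.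
    by rewrite -hE1 sumr_ge0// => s _; rewrite sqr_ge0.
  lra.
have hd := tau_defect n x y xy; rewrite -/h in hd.
(* The induction hypothesis is used for each letter [s], with the weights [a * sqrt (p s)] and
   [b * sqrt (q s)] and with agreement [n.+1]. *)
apply: (@le_trans _ _ (\sum_s (
    (a ^+ 2 * p s + b ^+ 2 * q s) * (v / 2 + K * t) + K / (2 * t) *
    ((a * Num.sqrt (p s) - b * Num.sqrt (q s)) ^+ 2 +
     2 * (a * b) * (Num.sqrt (p s) * Num.sqrt (q s)) * tau n.+1)))).
  apply: ler_sum => s _.
  have := IHm _ _ _ (a * Num.sqrt (p s)) (b * Num.sqrt (q s)) FvS
    (agree_scons n s x y xy)
    (mulr_ge0 a0 (sqrtr_ge0 _)) (mulr_ge0 b0 (sqrtr_ge0 _)).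
  rewrite !exprMn !sqr_sqrtr ?g_ge0// !mulrA.
  by congr (_ <= _ + _ * (_ + _ * _)); ring.
rewrite big_split/= -mulr_suml big_split/= -!mulr_sumr.
rewrite (g_sum1 x) (g_sum1 y) !mulr1.
rewrite lerD2l ler_wpM2l// big_split/= hE -mulr_suml -mulr_sumr -/h.
have ab0 : 0 <= 2 * (a * b) by do 2 rewrite mulr_ge0//.
rewrite -subr_ge0.
(* The slack splits into two nonnegative parts: the one in [tau_defect], and
   [(1 - h) * tau n.+1]. *)
have -> : (a - b) ^+ 2 + 2 * (a * b) * tau n -
  (a ^+ 2 + b ^+ 2 - 2 * (a * b) * h + 2 * (a * b) * h * tau n.+1) =
  2 * (a * b) * ((tau n - tau n.+1 - (1 - h)) + (1 - h) * tau n.+1) by ring.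
by rewrite mulr_ge0// addr_ge0 ?subr_ge0// mulr_ge0// subr_ge0.
Qed.

End affinity_defect.

Lemma agree_varn g n x y : agree n x y -> (`|g x - g y|%:E <= varn g n)%E.
Proof. by move=> xy; apply: ereal_sup_ubound; exists (x, y). Qed.

Lemma varn_ge0 g n : (0 <= varn g n)%E.
Proof. by rewrite (le_trans _ (@agree_varn g n point point _)). Qed.

(** [tau n] is the tail starting at [n.+1]: points that agree in [n] coordinates agree in [n.+1]
    after a letter is prepended, so the term removed between [tau n] and [tau n.+1] must be the
    square of [varn g n.+1]. *)
Lemma varn_sqr_summable_tail g :
    (varn g 0 < +oo)%E -> (\sum_(1 <= n <oo) varn g n ^+ 2 < +oo)%E ->
  exists tau : nat -> R, [/\ forall n, 0 <= tau n, tau n @[n --> \oo] --> 0 &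
    forall n x y, agree n.+1 x y -> (g x - g y) ^+ 2 <= tau n - tau n.+1].
Proof.
move=> g0 gfin; have V0 k : (0 <= varn g k ^+ 2)%E.
  by rewrite expe2 mule_ge0// varn_ge0.
pose T n := (\sum_(n.+1 <= k <oo) varn g k ^+ 2)%E.
have T0 n : (0 <= T n)%E by apply: nneseries_ge0 => k _ _; exact: V0.
have TS n : (T n = varn g n.+1 ^+ 2 + T n.+1)%E.
  by rewrite /T (nneseries_split _ 1)// addn1 big_nat1.
have Toon n : (T n < +oo)%E.
  elim: n => // n; rewrite TS; apply: le_lt_trans.
  by rewrite leeDr.
have Tfin n : T n \is a fin_num by rewrite ge0_fin_numE.
exists (fine \o T); split=> [n||n x y xy]; first by rewrite fine_ge0.
- apply: fine_cvg.
  (* The tails are those of the series started at 0, whose extra term is finite by [g0]. *)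
  have := @nneseries_tail_cvg _ (fun k => varn g k ^+ 2)%E xpredT.
  rewrite nneseries_recl//.
  move=> /(_ _ (fun k _ => V0 k)); rewrite -(cvg_shiftS (fun N => _)); apply.
  rewrite lte_add_pinfty// expe2 lte_mul_pinfty ?varn_ge0//.
  by rewrite ge0_fin_numE ?varn_ge0.
- have Vfin : (varn g n.+1 ^+ 2)%E \is a fin_num.
    by rewrite ge0_fin_numE// (le_lt_trans _ (Toon n))// TS leeDl.
  rewrite /= TS fineD// addrK -lee_fin fineK// -real_normK ?num_real//.
  rewrite EFin_expe.
  by rewrite !expe2 lee_pmul ?lee_fin// agree_varn.
Qed.

Lemma g_function_sum1 g : g_function g ->
  forall x, \sum_(s : S) g (scons s x) = 1.
Proof.
move=> [_ _ gsum] x; have := transfer_opE g (cst 1) x; rewrite /transfer_op.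
under eq_fsbigr do rewrite mulr1; under [in RHS]eq_bigr do rewrite mulr1.
by move=> <-; rewrite gsum.
Qed.

Lemma iter_transfer_op_equicontinuous g f (e : R) :
    g_function g -> (forall x, 0 < g x) ->
    (\sum_(1 <= n <oo) varn g n ^+ 2 < +oo)%E -> continuous f -> 0 < e ->
  exists n, forall m x y, agree n x y ->
    `|iter m (transfer_op g) f x - iter m (transfer_op g) f y| <= e.
Proof.
move=> g_fun g_gt0 gvar cf e0.
have [cg g01 _] := g_fun; have g_sum1 := g_function_sum1 g g_fun.
have g0oo : (varn g 0 < +oo)%E.
  rewrite (@le_lt_trans _ _ 1%:E) ?ltry//.
  apply: ub_ereal_sup => _ [[x y] _ <-]; rewrite lee_fin/= ler_norml.
  have /andP[? ?] := g01 x; have /andP[? ?] := g01 y.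
  by apply/andP; split; lra.
have [c c0 gc] := continuous_gt0_lbound g cg g_gt0.
have [K K0 fK] := continuous_shift_space_bounded f cf.
have [T [T0 Tcvg TV]] := varn_sqr_summable_tail g g0oo gvar.
pose C : R := #|S|%:R / (2 * c).
have C0 : 0 <= C by rewrite divr_ge0// mulr_ge0// ltW.
(* With [a = b = 1] the weighted bound is [e / 4 + 2 * (K * t) + C * T n * (K / t)]. This [t] makes
   the middle term [e / 2], leaving [e / 4] for the tail. *)
pose t := e / (4 * K).
have t0 : 0 < t by rewrite divr_gt0// mulr_gt0.
have e4 : 0 < e / 4 by rewrite divr_gt0.
have [n1 fn1] := continuous_agree f (e / 4) cf e4.
have [n2 Tn2] : exists n2, forall n, (n2 <= n)%N -> C * T n * (K / t) <= e / 4.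
  have : C * T n * (K / t) @[n --> \oo] --> C * 0 * (K / t).
    by apply: cvgMl; apply: cvgMr.
  rewrite mulr0 mul0r => /cvgrPdist_le/(_ _ e4)[n2 _ h]; exists n2 => n /h.
  by rewrite sub0r normrN; apply: le_trans; exact: ler_norm.
exists (maxn n1 n2) => m x y xy; set n := maxn n1 n2 in xy *.
have tau_defect k x' y' : agree k x' y' ->
    1 - \sum_(s : S) Num.sqrt (g (scons s x')) * Num.sqrt (g (scons s y')) <=
    C * T k - C * T k.+1.
  move=> xy'; rewrite -mulrBr; apply: sqrt_affinity_defect => // s.
    by rewrite ltW.
  by apply: TV; exact: agree_scons.
have fn x' y' : agree n x' y' -> `|f x' - f y'| <= e / 4.
  move=> xy'; apply: fn1 => i ni; apply: xy'.
  by rewrite (leq_trans ni)// leq_maxl.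
have := @iter_transfer_op_weighted_agree g (fun n => C * T n)
  (fun x => ltW (g_gt0 x)) g_sum1 (fun n => mulr_ge0 C0 (T0 n)) tau_defect
  f n m x y K (e / 4) t 1 1 t0 fK fn xy ler01 ler01.
rewrite !expr1n !mul1r => /le_trans; apply.
have -> : (1 + 1) * (e / 4 / 2 + K * t) +
    K / (2 * t) * ((1 - 1) ^+ 2 + 2 * 1 * (C * T n)) =
    e / 4 + 2 * (K * t) + C * T n * (K / t) :> R by field; rewrite gt_eqF.
have -> : K * t = e / 4 by rewrite /t; field; rewrite gt_eqF.
have := Tn2 n (leq_maxr _ _); lra.
Qed.

End equicontinuity.

(** * Integration against [comp_shift mu] and invariance of the integral under the transfer
    operator *)

Section integration.
Context {R : realType} {S : pointedFinType}.
Implicit Types F g : shift_space S -> R.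

Lemma continuous_integrable
    (mu : {finite_measure set (shift_space S) -> \bar R}) F :
  continuous F -> mu.-integrable setT (EFin \o F).
Proof.
move=> cF; have [K K0 FK] := continuous_shift_space_bounded F cF.
apply: measurable_bounded_integrable => //.
- by rewrite ltey_eq fin_num_measure.
- exact: continuous_measurable.
- exists K; split; first exact: num_real.
  by move=> M KM x _; exact: le_trans (FK x) (ltW KM).
Qed.

Lemma measurable_cylinder (s : S) : measurable (@cylinder S s).
Proof.
apply: sub_sigma_algebra.
have -> : cylinder s =
    (fun x : shift_space S => x 0%N : discrete_topology S) @^-1` [set s].
  by [].
apply: open_comp => [x _|]; last exact: discrete_open.
exact: (@proj_continuous nat (fun=> discrete_topology S)).
Qed.

(** The space is cut into the cylinders of the letters; on the cylinder of [s], [comp_shift mu]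
    coincides with the image of [mu] under [scons s]. *)
Lemma integral_comp_shift
    (mu : {finite_measure set (shift_space S) -> \bar R}) F :
  continuous F ->
  (\int[comp_shift mu]_x (F x)%:E =
   \int[mu]_x (\sum_(s : S) F (scons s x))%:E)%E.
Proof.
move=> cF; have mF : measurable_fun setT (EFin \o F).
  by apply/measurable_EFinP; exact: continuous_measurable.
have cFs s : continuous (F \o scons s).
  by move=> x; exact: (continuous_comp (@scons_continuous S s x) (cF _)).
under [in RHS]eq_integral do rewrite -sumEFin.
rewrite (@integral_sum _ _ _ _ _ measurableT _
  (fun s x => (F (scons s x))%:E)); last first.
  by move=> s; exact: continuous_integrable (cFs s).
rewrite [in LHS](_ : [set: shift_space S] =
    \big[setU/set0]_(s : S) cylinder s); last first.
  rewrite -bigcup_seq; apply/seteqP; split=> // x _.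
  by exists (x 0%N) => //=; rewrite mem_index_enum.
rewrite integral_bigsetU_EFin//=; last 4 first.
- by move=> s; exact: measurable_cylinder.
- exact: index_enum_uniq.
- by move=> s t _ _ [x [<- <-]].
- by apply: measurable_funS mF.
apply: eq_bigr => s _.
transitivity (\int[mu]_(x in scons s @^-1` cylinder s)
    (F (scons s x))%:E)%E; last first.
  by congr (integral _ _ _); apply/seteqP; split.
rewrite -(@integral_pushforward _ _ _ _ _ _ (measurable_scons s) mu
  (cylinder s) (EFin \o F))//.
- apply: eq_measure_integral => [|mscons A mA As].
    exact: measurable_scons.
  (* A subset of the cylinder of [s] misses all other cylinders, so only the term of [s]
     survives. *)
  rewrite /= /comp_shift (bigD1 s)//= big1 => [|t ts].
    by rewrite adde0 shift_cylinderE.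
  rewrite (_ : A `&` _ = set0) ?image_set0 ?measure0//.
  apply/seteqP; split=> // x [/As xs xt].
  by move: ts; rewrite -xs -xt eqxx.
- have -> : scons s @^-1` cylinder s = setT by apply/seteqP.
  exact: continuous_integrable (cFs s).
- exact: measurable_cylinder.
Qed.

(** As [g] is the density of [mu] with respect to [comp_shift mu], the integral of [F] is that of
    [g * F] against [comp_shift mu]; summing [g * F] over the prepended letter gives
    [transfer_op g F]. *)
Lemma g_measure_transfer_op g (mu : probability (shift_space S) R) F :
  g_measure g mu -> continuous g -> continuous F ->
  \int[mu]_x transfer_op g F x = \int[mu]_x F x.
Proof.
move=> [_ mu_dom mu_rn] cg cF; rewrite /Rintegral; congr fine.
have iF : mu.-integrable setT (EFin \o F) by exact: continuous_integrable.
rewrite -(Radon_Nikodym_change_of_variables mu_dom measurableT iF).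
transitivity (\int[comp_shift mu]_x (g x * F x)%:E)%E.
  rewrite integral_comp_shift; last first.
    by move=> x; exact: (continuousM (cg x) (cF x)).
  by apply: eq_integral => x _; rewrite transfer_opE.
apply: ae_eq_integral => //.
- apply/measurable_EFinP; apply: continuous_measurable => x.
  exact: (continuousM (cg x) (cF x)).
- apply: emeasurable_funM.
    by apply/measurable_EFinP; exact: continuous_measurable.
  by apply: (measurable_int (comp_shift mu)); apply: Radon_Nikodym_integrable.
- apply: filterS mu_rn => x /(_ I) /= -> _.
  by rewrite -EFinM mulrC.
Qed.

End integration.

(** * Uniform convergence of the iterates to the integral *)

Theorem theorem2p2 (R : realType) (S : pointedFinType) (g : shift_space S -> R)
    (g_fun : g_function g) (g_gt0 : forall x, 0 < g x)
    (g_var : (\sum_(1 <= n <oo) varn g n ^+ 2 < +oo)%E)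
    (mu : probability (shift_space S) R) (mu_g : g_measure g mu)
    (f : shift_space S -> R) (cf : continuous f) :
  ereal_sup [set `|iter n (transfer_op g) f x - \int[mu]_y f y|%:E | x in setT]
    @[n --> \oo] --> 0%E.
Proof.
have [cg g01 _] := g_fun; have g_sum1 := g_function_sum1 g g_fun.
have [c c0 gc] := continuous_gt0_lbound g cg g_gt0.
have c1 : c <= 1 by rewrite (le_trans (gc point))//; case/andP: (g01 point).
have [K K0 fK] := continuous_shift_space_bounded f cf.
have cL n : continuous (iter n (transfer_op g) f).
  by elim: n => //= n; exact: continuous_transfer_op.
have mu_inv n : \int[mu]_x iter n (transfer_op g) f x = \int[mu]_x f x.
  by elim: n => //= n <-; exact: g_measure_transfer_op.
pose D n := ereal_sup
  [set `|iter n (transfer_op g) f x - \int[mu]_y f y|%:E | x in setT].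
have D0 n : (0 <= D n)%E.
  apply: ereal_sup_ge.
  by exists `|iter n (transfer_op g) f point - \int[mu]_y f y|%:E.
suff De e : 0 < e -> \forall n \near \oo, (D n <= e%:E)%E.
  suff : D n @[n --> \oo] --> 0%E by [].
  apply/fine_cvgP; split; last apply/cvgrPdist_le => e e0.
    (* The bound with [e = 1] makes the supremum eventually finite, so that the limit can be taken
       in [R]. *)
    apply: filterS (De 1 ltr01) => n Dn.
    by rewrite ge0_fin_numE// (le_lt_trans Dn)// ltry.
  apply: filterS (De e e0) => n Dn /=.
  have Dfin : D n \is a fin_num.
    by rewrite ge0_fin_numE// (le_lt_trans Dn)// ltry.
  by rewrite sub0r normrN ger0_norm ?fine_ge0// -lee_fin fineK.
move=> e0; have e3 : 0 < e / 3 by rewrite divr_gt0.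
have [n fn] :=
  iter_transfer_op_equicontinuous g f (e / 3) g_fun g_gt0 g_var cf e3.
have [k ke] : exists k, (1 - c ^+ n) ^+ k * (2 * K) <= e / 3.
  have : `|1 - c ^+ n| < 1.
    rewrite ger0_norm ?subr_ge0 ?exprn_ile1// ?ltW//.
    by rewrite ltrBlDr ltrDl exprn_gt0.
  move=> /cvg_expr h.
  have : (1 - c ^+ n) ^+ k * (2 * K) @[k --> \oo] --> 0 * (2 * K).
    by apply: cvgMl.
  rewrite mul0r => /cvgrPdist_le/(_ _ e3)[k _ /(_ k (leqnn k)) hk]; exists k.
  by move: hk; rewrite sub0r normrN; apply: le_trans; exact: ler_norm.
have [m [M [mLM Mm]]] :=
  transfer_op_iter_contraction g c g_sum1 (ltW c0) gc f K n (e / 3) c1 fK fn k.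
(* Averaging preserves bounds, so every iterate from rank [k * n] on stays in [[m, M]], of length at
   most [2 * (e / 3) + e / 3 = e]. *)
exists (k * n)%N => //= j kj; apply: ub_ereal_sup => _ [x _ <-].
have mLjM y : m <= iter j (transfer_op g) f y <= M.
  rewrite -(subnK kj) iterD.
  exact: (iter_transfer_op_bounds g c g_sum1 (ltW c0) gc).
(* Written as the integral of the [j]-th iterate against a probability, the limit lies in [[m, M]]
   too. *)
rewrite lee_fin -(mu_inv j).
have iL : mu.-integrable setT (EFin \o iter j (transfer_op g) f).
  exact: continuous_integrable.
have icst (r : R) : mu.-integrable setT (EFin \o cst r).
  exact: finite_measure_integrable_cst.
have cstE (r : R) : \int[mu]_x r = r.
  by rewrite Rintegral_cst//= [X in fine X](@probability_setT _ _ _ mu) mulr1.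
have Im : m <= \int[mu]_y iter j (transfer_op g) f y.
  rewrite -[leLHS]cstE; apply: le_Rintegral => // [|y _]; first exact: icst.
  by case/andP: (mLjM y).
have IM : \int[mu]_y iter j (transfer_op g) f y <= M.
  rewrite -[leRHS]cstE; apply: le_Rintegral => // [|y _]; first exact: icst.
  by case/andP: (mLjM y).
have /andP[? ?] := mLjM x; rewrite ler_norml; apply/andP; split; lra.
Qed.
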